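(* Let $A$ be a balanced matrix (with entries in $\{0,1\}$) with distinct column vectors $v_1,\ldots,v_q\in\{0,1\}^n$. If there is an integer $d$ such that $|v_i|=d$ for all $i$, then any regular triangulation of the cone $\mathbb{R}_+\{v_1,\ldots,v_q\}$ is unimodular.
   Context: For a vector $v$, $|v|$ denotes the sum of its entries. A matrix with entries in $\{0,1\}$ is balanced if it has no square submatrix of odd order with exactly two $1$'s in each row and column. Let $\mathcal{A}=\{v_1,\ldots,v_q\}$; $\mathbb{R}_+\mathcal{A}$ denotes the cone of non-negative real linear combinations of elements of $\mathcal{A}$, and $\mathbb{Z}\mathcal{A}$ the subgroup of $\mathbb{Z}^n$ generated by $\mathcal{A}$. Regular triangulations: let $K$ be a field, $S=K[t_1,\ldots,t_q]$ a polynomial ring, $\varphi:S\to K[x^{v_1},\ldots,x^{v_q}]\subset K[x_1,\ldots,x_n]$ the $K$-algebra homomorphism with $\varphi(t_i)=x^{v_i}$, and $P=\ker\varphi$ the toric ideal. Let $\prec$ be a term order on $S$ with initial ideal $\mathrm{in}_\prec(P)$, and let $\Delta$ be the simplicial complex on $t_1,\ldots,t_q$ whose Stanley-Reisner ideal is $\mathrm{rad}(\mathrm{in}_\prec(P))$. Writing $\mathrm{rad}(\mathrm{in}_\prec(P))=\mathfrak{p}_1\cap\cdots\cap\mathfrak{p}_m$ as the irredundant intersection of its minimal primes (each generated by a subset of the variables), the facets of $\Delta$, with $t_j$ identified with $v_j$, are $\mathcal{A}_i=\{v_j \mid t_j\notin\mathfrak{p}_i\}$, $i=1,\ldots,m$.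 Equivalently, if $\omega\in\mathbb{N}^q$ is a weight vector with $\mathrm{in}_\prec(P)=\mathrm{in}_\omega(P)$ (such $\omega$ always exists), then $\Delta$ consists of those $\sigma$ for which there is $c\in\mathbb{R}^n$ with $\langle v_i,c\rangle=\omega_i$ if $t_i\in\sigma$ and $\langle v_i,c\rangle<\omega_i$ if $t_i\notin\sigma$. The family $\{\mathcal{A}_1,\ldots,\mathcal{A}_m\}$ (equivalently the family of cones $\mathbb{R}_+\mathcal{A}_1,\ldots,\mathbb{R}_+\mathcal{A}_m$) is called a regular triangulation of $\mathcal{A}$ (resp. of the cone $\mathbb{R}_+\mathcal{A}$). It is called unimodular if $\mathbb{Z}\mathcal{A}_i=\mathbb{Z}\mathcal{A}$ for all $i$. *)

(* Defs.v *)
From HB Require Import structures.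
From mathcomp Require Import all_boot all_order all_algebra.
From mathcomp Require Export mpoly.

Set Implicit Arguments.
Unset Strict Implicit.
Unset Printing Implicit Defensive.

Import GRing.Theory.
Local Open Scope ring_scope.

(* Matrices with non-negative integer entries; 0/1 entries are imposed below. *)

Definition zero_one n q (A : 'M[nat]_(n, q)) : Prop :=
  forall i j, A i j = 0%N \/ A i j = 1%N.

Definition two_ones k (B : 'M[nat]_k) : Prop :=
  (forall i, #|[set j | B i j == 1%N]| = 2%N) /\
  (forall j, #|[set i | B i j == 1%N]| = 2%N).

(* Rows and columns are selected injectively but not necessarily in increasing
   order, which does not affect the property [two_ones]. *)
Definition balanced n q (A : 'M[nat]_(n, q)) : Prop :=
  zero_one A /\
  forall k (f : 'I_k -> 'I_n) (g : 'I_k -> 'I_q),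
    odd k -> injective f -> injective g -> ~ two_ones (mxsub f g A).

Definition colvec n q (A : 'M[nat]_(n, q)) (j : 'I_q) : 'cV[int]_n :=
  \col_i (A i j)%:Z.

Definition vsum n (v : 'cV[int]_n) : int := \sum_i v i 0.

Definition ZSpan n q (A : 'M[nat]_(n, q)) (s : {set 'I_q}) (u : 'cV[int]_n) :
    Prop :=
  inIntSpan (in_tuple [seq colvec A j | j in s]) u.

Section Ideals.
Variables (K : fieldType) (q : nat).
Implicit Types (I G : {mpoly K[q]} -> Prop).

Definition ideal_gen G (f : {mpoly K[q]}) : Prop :=
  exists s : seq ({mpoly K[q]} * {mpoly K[q]}),
    (forall p, p \in s -> G p.2) /\ f = \sum_(p <- s) p.1 * p.2.

Definition radical I (f : {mpoly K[q]}) : Prop := exists k : nat, I (f ^+ k).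

(* [le m1 m2] is the non-strict order on exponent vectors.  That [0] is the
   least exponent is equivalent to well-foundedness of the order. *)
Definition term_order (le : rel 'X_{1..q}) : Prop :=
  [/\ reflexive le, antisymmetric le, transitive le, total le &
    (forall m, le 0%MM m) /\
    (forall m1 m2 m, le m1 m2 -> le (m1 + m)%MM (m2 + m)%MM)].

Definition is_lead (le : rel 'X_{1..q}) (f : {mpoly K[q]}) (m : 'X_{1..q}) :
    Prop :=
  m \in msupp f /\ forall m', m' \in msupp f -> le m' m.

(* Over a field, leading monomials generate the same ideal as leading terms. *)
Definition initial_ideal (le : rel 'X_{1..q}) I : {mpoly K[q]} -> Prop :=
  ideal_gen (fun g => exists f m, [/\ I f, is_lead le f m & g = 'X_[m]]).

Definition simplicial_complex (Delta : {set {set 'I_q}}) : Prop :=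
  forall s t : {set 'I_q}, t \in Delta -> s \subset t -> s \in Delta.

Definition SR_ideal (Delta : {set {set 'I_q}}) : {mpoly K[q]} -> Prop :=
  ideal_gen (fun g => exists s : {set 'I_q},
    s \notin Delta /\ g = \prod_(i in s) 'X_i).

End Ideals.

Definition facets q (Delta : {set {set 'I_q}}) : {set {set 'I_q}} :=
  [set s | maxset (fun t => t \in Delta) s].

Section Toric.
Variables (K : fieldType) (n q : nat) (A : 'M[nat]_(n, q)).

(* The K-algebra morphism sending t_j to x^{v_j}. *)
Definition toric_map (f : {mpoly K[q]}) : {mpoly K[n]} :=
  comp_mpoly [tuple 'X_[ [multinom A i j | i < n] ] | j < q] f.

Definition toric_ideal (f : {mpoly K[q]}) : Prop := toric_map f = 0.

(* A triangulation is given by its family of facets, each facet A_i being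
   encoded by the set of indices j such that v_j belongs to A_i. *)
Definition regular_triangulation (F : {set {set 'I_q}}) : Prop :=
  exists (le : rel 'X_{1..q}) (Delta : {set {set 'I_q}}),
    [/\ term_order le, simplicial_complex Delta,
        (forall f, SR_ideal Delta f <->
                   radical (initial_ideal le toric_ideal) f)
      & F = facets Delta].

End Toric.

Definition unimodular_family n q (A : 'M[nat]_(n, q)) (F : {set {set 'I_q}}) :
    Prop :=
  forall s, s \in F -> forall u, ZSpan A s u <-> ZSpan A [set: 'I_q] u.

(* Main.v *)
(** In a balanced matrix, the rows (with repetitions) can be coloured with [N]
    colours so that a column with at most [N] ones never sees a colour twice
    (Berge).  Let [B] be the submatrix of some linearly independent columns
    and [w] a vector vanishing on all of them but one.  Since all the columns
    have the same sum, [w] plus a large constant is a positive weight on the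
    rows that is constant on the columns but one; colouring the rows repeated
    according to this weight and taking the difference of two colour classes
    yields an integral vector that is [1] on one column of [B] and [0] on the
    others.  Hence [B] has an integral left inverse, and the lattice spanned by
    its columns is saturated.

    It remains to see that a facet of the complex of the initial ideal indexes a
    basis of the column space over the rationals.  A set [s] is a non-face iff
    the lattice of relations between the columns has a positive element (for
    the term order) with no positive entry outside [s].  Independence of a
    face is then clear, since a relation or its opposite is positive, and the
    facets span by an M-matrix argument. *)

Require Import Defs.
From mathcomp Require Import all_boot all_order all_algebra.
From mathcomp Require Import zify.

Set Implicit Arguments.
Unset Strict Implicit.
Unset Printing Implicit Defensive.

Import Order.TTheory GRing.Theory Num.Theory.

(** * Colourings of balanced matrices *)

Lemma ordS_neq k (t : 'I_k) : 1 < k -> ordS t != t.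
Proof.
move=> k1; apply/eqP => /(congr1 val) /=; have := ltn_ord t.
rewrite leq_eqVlt => /orP[/eqP e|l]; last by rewrite modn_small //; lia.
by rewrite e modnn; lia.
Qed.

Lemma ordSS_neq k (t : 'I_k) : 2 < k -> ordS (ordS t) != t.
Proof.
move=> k2; apply/eqP => /(congr1 val) /=; have := ltn_ord t.
rewrite leq_eqVlt => /orP[/eqP e|l]; first by rewrite e modnn modn_small; lia.
rewrite (modn_small l); move: (l); rewrite leq_eqVlt => /orP[/eqP e|l'].
  by rewrite e modnn; lia.
by rewrite modn_small //; lia.
Qed.

Section Coloring.
Variables (n q : nat) (A : 'M[nat]_(n, q)) (T : finType) (pi : T -> 'I_n).
Hypothesis balA : balanced A.

(* [T] is the set of rows of [A] with repetitions, so that colourings of [T]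
   are colourings of a multiset of rows. *)
Definition edge (j : 'I_q) : {set T} := [set x | A (pi x) j == 1].

(** With the [p t] as rows and the [g t] as columns, the incidences [s = t] and [s = ordS t] form a
    submatrix of odd order with two ones in each row and column. *)
Lemma no_odd_cycle (W : {set T}) k (p : 'I_k -> T) (g : 'I_k -> 'I_q) :
    odd k -> 1 < k -> injective p ->
  ~ (forall t, W :&: edge (g t) = [set p t; p (ordS t)]).
Proof.
move=> oddk k1 injp Eg; have k2 : 2 < k by case: k oddk k1 {p g injp Eg} => [|[|[]]].
have inE' s t : (p s \in edge (g t)) = (s == t) || (s == ordS t).
  have pW : p s \in W.
    by have /setIP[] : p s \in W :&: edge (g s) by rewrite Eg set21.
  have -> : (p s \in edge (g t)) = (p s \in W :&: edge (g t)) by rewrite in_setI pW.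
  by rewrite Eg !inE !(inj_eq injp).
have nSS (s t : 'I_k) : s == ordS t -> t == ordS s -> False.
  by move=> /eqP -> /eqP e; have := ordSS_neq t k2; rewrite -e eqxx.
apply: (proj2 balA k (pi \o p) g oddk).
(* [pi] need not be injective, but copies of one row lie in the same edges, whereas distinct
   vertices of a cycle of length at least 3 do not. *)
- move=> s t /= e; apply/eqP.
  have : p t \in edge (g s) by rewrite inE -e; have := inE' s s; rewrite inE eqxx.
  have : p s \in edge (g t) by rewrite inE e; have := inE' t t; rewrite inE eqxx.
  rewrite !inE' [t == s]eq_sym; case: (s == t) => //= h1 h2.
  by case: (nSS s t).
- move=> s t e; have := inE' s s; have := inE' t t; rewrite !eqxx /= -{1}e {2}e !inE'.
  rewrite [t == s]eq_sym; case: eqP => //= _ h1 h2; by case: (nSS s t).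
- have E s t : (mxsub (pi \o p) g A s t == 1) = (s == t) || (s == ordS t).
    by rewrite mxE -inE' inE.
  split=> s.
    rewrite (_ : [set _ | _] = [set s; ord_pred s]).
      rewrite cards2; case: eqP => // e; have := ordS_neq (ord_pred s) k1.
      by rewrite ord_predK -e eqxx.
    apply/setP => t; rewrite !inE E eq_sym; congr (_ || _).
    by rewrite eq_sym (can2_eq (@ordSK k) (@ord_predK k)).
  rewrite (_ : [set _ | _] = [set s; ordS s]); last by apply/setP => t; rewrite !inE E.
  by rewrite cards2 eq_sym ordS_neq.
Qed.

(* Take an endpoint [v] of a longest path in the graph of the edges that meet
   [W] in two points: all the neighbours of [v] lie on that path, and at even
   distance from one another since there is no odd cycle.  So they have the
   same colour in any bicolouring of [W :\ v]. *)
Lemma bicoloring (W : {set T}) :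
  exists h : T -> bool, forall j, 1 < #|W :&: edge j| ->
    exists x y, [/\ x \in W :&: edge j, y \in W :&: edge j, h x & ~~ h y].
Proof.
have [m] := ubnP #|W|; elim: m W => // m IH W leW.
(* Loops [adj x x] are possible: an edge may meet [W] in one point. *)
pose adj x y := [exists j, W :&: edge j == [set x; y]].
have adjC x y : adj x y = adj y x.
  by apply: eq_existsb => j; rewrite setUC.
have [W0|/set0Pn[v0 v0W]] := eqVneq W set0.
  by exists predT => j; rewrite W0 set0I cards0.
pose P l := [exists t : l.-tuple T, [&& uniq t, sorted adj t & all (mem W) t]].
have P1 : exists l, P l.
  by exists 1%N; apply/existsP; exists [tuple v0]; rewrite /= v0W.
have Pb l : P l -> l <= #|T|.
  by case/existsP => t /and3P[/card_uniqP e _ _]; rewrite -(size_tuple t) -e max_card.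
case: (ex_maxnP P1 Pb) => l /existsP[t /and3P[tu ts tW]] lmax.
have l0 : 0 < l by apply: lmax; apply/existsP; exists [tuple v0]; rewrite /= v0W.
have := size_tuple t; case: (tval t) tu ts tW => [|v s]; first by move: l0; case: (l).
move=> /= /andP[vs us] ps /andP[vW sW] sl.
have nbr y : y != v -> adj v y -> y \in s.
  move=> yv avy; apply: contraTT isT => ys.
  have : l.+1 <= l; last by rewrite ltnn.
  apply: lmax; apply/existsP.
  have szE : size [:: y, v & s] == l.+1 by rewrite /= sl.
  exists (Tuple szE) => /=; rewrite inE negb_or yv ys vs us adjC avy ps vW sW /=.
  case/existsP: avy => j /eqP e; rewrite !andbT.
  by have /setIP[] : y \in W :&: edge j by rewrite e set22.
have [|h hP] := IH (W :\ v); first by move: leW; rewrite (cardsD1 v W) vW.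
have h_adj x y : x \in s -> y \in s -> x != y -> adj x y -> h y = ~~ h x.
  move=> xs ys xy /existsP[j /eqP e].
  have vn z : z \in s -> z != v by move=> zs; apply: contraNneq vs => <-.
  have e' : (W :\ v) :&: edge j = [set x; y].
    rewrite setIDAC e; apply/setDidPl; rewrite disjoint_sym disjoints1 !inE negb_or.
    by rewrite ![v == _]eq_sym !vn.
  have := hP j; rewrite e' cards2 xy => /(_ isT) [a [b [/set2P[]-> /set2P[]->]]] => //;
    by case: (h x); case: (h y).
have nth_adj i : i.+1 < size s -> adj (nth v s i) (nth v s i.+1).
  by move=> lt; move/(pathP v)/(_ i.+1 lt): ps.
have h_nth i : i < size s -> h (nth v s i) = odd i (+) h (nth v s 0).
  elim: i => // i IHi lt; have lt' := ltnW lt.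
  rewrite (h_adj (nth v s i)) ?mem_nth ?IHi ?addNb ?nth_adj //.
  by rewrite nth_uniq // neq_ltn ltnSn.
(* For odd [i], such a neighbour would close [v] and the first [i.+1] vertices of [s] into a cycle
   of odd length [i.+2]. *)
have even_nbr i : i < size s -> adj v (nth v s i) -> ~~ odd i.
  move=> lt av; apply/negP => oi.
  pose p (t : 'I_i.+2) := nth v (v :: s) t.
  have injp : injective p.
    move=> a b /eqP; rewrite /p nth_uniq ?(leq_trans (ltn_ord _)) //=; last by rewrite vs.
    by move/eqP/val_inj.
  have /fin_all_exists[g gP] (t' : 'I_i.+2) :
      exists j, W :&: edge j = [set p t'; p (ordS t')].
    suff /existsP[j /eqP] : adj (p t') (p (ordS t')) by exists j.
    rewrite /p /=; case: t' => a /=; rewrite ltnS leq_eqVlt => /orP[/eqP ->|lta].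
      by rewrite modnn /= adjC.
    rewrite modn_small //.
    by move/(pathP v)/(_ a): ps; apply; apply: leq_trans lta _.
  by apply: (no_odd_cycle _ _ injp gP); rewrite //= oi.
(* All the neighbours of [v] have the colour of the head of [s]; if [s] is empty, [v] has no
   neighbour but possibly itself and its colour is arbitrary. *)
pose h' x := if x == v then ~~ h (head v s) else h x.
have h'P x y j : [/\ x \in (W :\ v) :&: edge j, y \in (W :\ v) :&: edge j, h x & ~~ h y] ->
    exists x y, [/\ x \in W :&: edge j, y \in W :&: edge j, h' x & ~~ h' y].
  case=> /setIP[/setD1P[xv xW] xj] /setIP[/setD1P[yv yW] yj] hx hy.
  by exists x, y; rewrite /h' (negbTE xv) (negbTE yv) !in_setI xW yW xj yj; split.
exists h' => j.
have [lt _|le] := boolP (1 < #|(W :\ v) :&: edge j|).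
  by have [x [y /h'P]] := hP j lt.
have [vj|vj] := boolP (v \in edge j); last first.
  rewrite (_ : W :&: edge j = (W :\ v) :&: edge j); first by rewrite (negbTE le).
  by rewrite setIDAC; apply/esym/setDidPl; rewrite disjoint_sym disjoints1 inE (negbTE vj) andbF.
rewrite (cardsD1 v) in_setI vW vj /= add1n ltnS -setIDAC => c1.
have /cards1P[y ey] : #|(W :\ v) :&: edge j| == 1.
  by rewrite eqn_leq c1 leqNgt le.
have yv : y != v by have /setIP[/setD1P[]] : y \in (W :\ v) :&: edge j by rewrite ey set11.
have ej : W :&: edge j = [set v; y].
  have vWj : v \in W :&: edge j by rewrite in_setI vW.
  by rewrite -(setD1K vWj) -setIDAC ey.
have avy : adj v y by apply/existsP; exists j; rewrite ej.
have ys := nbr y yv avy.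
have hy : h y = h (head v s).
  have := even_nbr (index y s); rewrite nth_index // index_mem => /(_ ys avy) /negbTE o.
  by have := h_nth (index y s); rewrite nth_index // index_mem o nth0; apply.
rewrite ej; case hh : (h (head v s)).
  by exists y, v; rewrite /h' set21 set22 eqxx (negbTE yv) hy hh.
by exists v, y; rewrite /h' set21 set22 eqxx (negbTE yv) hy hh.
Qed.

(* In a colouring maximising the total number of colours seen by the edges, an
   edge with a repeated colour [a] misses some colour [b]; recolouring the
   union of these two classes by a bicolouring would increase the total. *)
Lemma good_coloring N :
  exists c : T -> 'I_N.+1, forall j, #|edge j| <= N.+1 -> {in edge j &, injective c}.
Proof.
pose seen (c : {ffun T -> 'I_N.+1}) j := #|c @: edge j|.
case: (@arg_maxnP _ [ffun=> ord0] predT (fun c => \sum_j seen c j) isT) => c _ cmax.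
exists c => j0 j0N; apply/imset_injP; rewrite eqn_leq leq_imset_card leqNgt /=.
apply/negP => lt.
have [b bP] : exists b, b \notin c @: edge j0.
  apply/existsP/contraT => /existsPn ball; have := leq_trans lt j0N.
  suff -> : c @: edge j0 = setT by rewrite cardsT card_ord ltnn.
  by apply/setP => b; have := ball b; rewrite negbK inE.
have [x0 [y0 [x0e y0e xy0 cxy]]] :
    exists x y, [/\ x \in edge j0, y \in edge j0, x != y & c x = c y].
  have : ~~ dinjectiveb c (edge j0).
    by apply: contraTN lt => /dinjectiveP/card_in_imset ->; rewrite ltnn.
  by case/dinjectivePn => x xe [y /andP[yx ye] e]; exists x, y; rewrite eq_sym.
pose a := c x0; pose W := [set x | c x \in [set a; b]].
have ab : a != b by apply: contraNneq bP => <-; rewrite imset_f.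
have [h hP] := bicoloring W.
pose c' := [ffun x => if x \in W then if h x then a else b else c x].
have c'W (X : {set T}) : X \subset W -> c' @: X \subset [set a; b].
  move=> /subsetP XW; apply/subsetP => _ /imsetP[x /XW xW ->].
  by rewrite ffunE xW; case: (h x); rewrite ?set21 ?set22.
have cW (X : {set T}) : X \subset W -> c @: X \subset [set a; b].
  by move=> /subsetP XW; apply/subsetP => _ /imsetP[x /XW xW ->]; rewrite inE in xW.
(* Points of [W] and points off [W] never share a colour, so [seen] splits and only the part in [W]
   changes. *)
have splitc (d : {ffun T -> 'I_N.+1}) j :
    (forall x, (d x \in [set a; b]) = (x \in W)) ->
    seen d j = #|d @: (edge j :\: W)| + #|d @: (W :&: edge j)|.
  move=> dW; rewrite /seen -[in LHS](setID (edge j) W) imsetU setUC setIC cardsU.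
  suff -> : d @: (edge j :\: W) :&: d @: (W :&: edge j) = set0 by rewrite cards0 subn0.
  apply/setP => z; rewrite !inE; apply/negP => /andP[/imsetP[x xe ->] /imsetP[y ye e]].
  move: xe ye; rewrite in_setD in_setI => /andP[xW _] /andP[yW _].
  by move: xW; rewrite -dW e dW yW.
have c'P x : (c' x \in [set a; b]) = (x \in W).
  rewrite ffunE; case: ifP => xW; first by case: (h x); rewrite ?set21 ?set22.
  by move: xW; rewrite inE.
have cP x : (c x \in [set a; b]) = (x \in W) by rewrite [in RHS]inE.
have out j : c' @: (edge j :\: W) = c @: (edge j :\: W).
  by apply: eq_in_imset => x; rewrite inE => /andP[/negbTE xW _]; rewrite ffunE xW.
have two j : 1 < #|W :&: edge j| -> #|c' @: (W :&: edge j)| = 2.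
  case/hP => x [y [xi yi hx hy]].
  suff -> : c' @: (W :&: edge j) = [set a; b] by rewrite cards2 ab.
  apply/eqP; rewrite eqEsubset c'W ?subsetIl //=; apply/subsetP => z /set2P[]->.
    by apply/imsetP; exists x => //; rewrite ffunE hx; case/setIP: xi => ->.
  by apply/imsetP; exists y => //; rewrite ffunE (negbTE hy); case/setIP: yi => ->.
have le2 j : #|c @: (W :&: edge j)| <= 2.
  by rewrite (leq_trans (subset_leq_card (cW _ (subsetIl _ _)))) // cards2 ab.
have leS j : seen c j <= seen c' j.
  rewrite !splitc // out leq_add2l.
  have [lt1|] := boolP (1 < #|W :&: edge j|); first by rewrite two.
  rewrite -leqNgt leq_eqVlt => /orP[/cards1P[x ->]|].
    by rewrite !imset_set1 !cards1.
  by rewrite ltnS leqn0 => /eqP/cards0_eq ->; rewrite !imset0.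
have ltS : seen c j0 < seen c' j0.
  rewrite !splitc // out ltn_add2l two; last first.
    by apply/card_gt1P; exists x0, y0; rewrite !in_setI x0e y0e !inE -cxy eqxx.
  rewrite ltnS -(cards1 a) subset_leq_card //; apply/subsetP => z zi.
  have := subsetP (cW _ (subsetIl _ (edge j0))) z zi; rewrite !inE => /orP[//|/eqP zb].
  by case/negP: bP; rewrite -zb; apply: subsetP zi; apply/imsetS/subsetIr.
have /= := cmax c' isT; rewrite leqNgt => /negP; apply.
by rewrite (bigD1 j0) //= [ltnRHS](bigD1 j0) //= -addSn leq_add // leq_sum.
Qed.

End Coloring.

(** * Integral dual vectors *)

Lemma Posz_sum (I : finType) (F : I -> nat) : Posz (\sum_i F i) = (\sum_i Posz (F i))%R.
Proof. exact: (big_morph Posz PoszD erefl). Qed.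

Section DualVector.
Local Open Scope ring_scope.

Lemma common_denominator m (x : 'I_m -> rat) :
  exists N (z : 'I_m -> int), N != 0 /\ forall i, (z i)%:~R = N%:~R * x i.
Proof.
exists (\prod_i denq (x i)), (fun i => numq (x i) * \prod_(j | j != i) denq (x j)).
split=> [|i]; first by apply/prodf_neq0 => i _; apply: denq_neq0.
rewrite [in RHS](bigD1 i) //= !intrM mulrAC -{3}[x i]divq_num_den.
by rewrite mulrCA divff ?intr_eq0 ?denq_neq0 // mulr1.
Qed.

Variables (n q : nat) (A : 'M[nat]_(n, q)) (s : {set 'I_q}).
Hypothesis free : forall a : 'I_q -> int, (forall k, k \notin s -> a k = 0) ->
  (forall r, \sum_k a k * (A r k)%:Z = 0) -> forall k, a k = 0.

(** By independence, column [i] is not a rational combination of the others in [s], so some column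
    of the cokernel matrix is orthogonal to these but not to it; it remains to clear denominators.
    The negative sign is what makes column [i] miss a colour in [dual_vector]. *)
Lemma separating_vector i : i \in s -> exists w : 'I_n -> int,
  (forall k, k \in s -> k != i -> \sum_r w r * (A r k)%:Z = 0) /\
  \sum_r w r * (A r i)%:Z < 0.
Proof.
move=> si; pose M : 'M[rat]_(q, n) :=
  \matrix_(k, r) (if (k \in s) && (k != i) then (A r k)%:R else 0).
pose v : 'rV[rat]_n := \row_r (A r i)%:R.
have [/submxP[D vE]|] := boolP (v <= M)%MS.
  have [N [z [N0 zP]]] := common_denominator (fun k => D 0 k).
  pose a k := if k == i then - N else if k \in s then z k else 0.
  have := @free a _ _ i; rewrite /a eqxx => a0; case/eqP: N0.
  apply: oppr_inj; rewrite oppr0; apply: a0 => [k ks|r].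
    by rewrite (negbTE ks); case: eqP ks => // ->; rewrite si.
  apply/eqP; rewrite -(intr_eq0 rat) rmorph_sum /= (bigD1 i) //= eqxx.
  have : N%:~R * v 0 r = N%:~R * (D *m M) 0 r by rewrite vE.
  rewrite !mxE mulr_sumr (bigD1 i) //= mxE eqxx andbF !mulr0 add0r => e.
  rewrite intrM rmorphN mulNr e addrC subr_eq0; apply/eqP/eq_bigr => k ki.
  rewrite mxE ki andbT (negbTE ki); case: ifP => _; last by rewrite !mulr0 mul0r.
  by rewrite intrM zP mulrA.
rewrite submxE => /eqP; rewrite -matrixP => ne.
have [r' [c ec]] : exists r c, (v *m cokermx M) r c != 0.
  have [/existsP[r /existsP[c]]|/existsPn h] :=
    boolP [exists r, exists c, (v *m cokermx M) r c != 0]; first by exists r, c.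
  case: ne => r c; rewrite [RHS]mxE; apply/eqP; have /existsPn/(_ c) := h r.
  by rewrite negbK.
have [N [z [N0 zP]]] := common_denominator (fun r => cokermx M r c).
pose S k := \sum_r z r * (A r k)%:Z.
have SE k : (S k)%:~R = N%:~R * \sum_r (A r k)%:R * cokermx M r c :> rat.
  rewrite rmorph_sum mulr_sumr; apply: eq_bigr => r _.
  by rewrite rmorphM /= zP mulrAC -mulrA.
have S0 k : k \in s -> k != i -> S k = 0.
  move=> ks ki; apply/eqP; rewrite -(intr_eq0 rat) SE.
  have : (M *m cokermx M) k c = 0 by rewrite mulmx_coker mxE.
  rewrite mxE => e; rewrite (eq_bigr (fun r => M k r * cokermx M r c)) ?e ?mulr0 //.
  by move=> r _; rewrite [M k r]mxE ks ki.
have Si : S i != 0.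
  rewrite -(intr_eq0 rat) SE mulf_neq0 ?intr_eq0 //.
  rewrite (_ : \sum_r _ = (v *m cokermx M) r' c) // [RHS]mxE.
  by apply: eq_bigr => r _; rewrite [v _ r]mxE.
have [lt|lt|e] := ltgtP (S i) 0; last by rewrite e eqxx in Si.
  by exists z.
have opp k : \sum_r - z r * (A r k)%:Z = - S k.
  by rewrite -sumrN; apply: eq_bigr => r _; rewrite mulNr.
exists (fun r => - z r); split=> [k ks ki|]; first by rewrite opp S0 ?oppr0.
by rewrite opp oppr_lt0.
Qed.

Lemma sum_tagged (I : finType) (p F : I -> nat) (G : {i : I & 'I_(p i)} -> nat) :
  (\sum_x F (tag x) * G x =
   \sum_i F i * \sum_(y < p i) G (Tagged (fun i => 'I_(p i)) y))%N.
Proof.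
under [RHS]eq_bigr do rewrite big_distrr.
rewrite (sig_big_dep _ _ (fun i y => F i * G (Tagged (fun i => 'I_(p i)) y))%N) /=.
by apply: eq_bigr => -[].
Qed.

(* Adding a large constant to a separating vector makes it a positive weight
   [p] on the rows with weight [N] on each column [k != i] of [s] and less than
   [N] on column [i].  In a good colouring by [N] colours of the rows, each
   repeated [p] times, every class meets each column [k != i] exactly once, and
   the classes meeting column [i] do so once; some do and some do not, so their
   difference is the desired vector. *)
Lemma dual_vector (balA : balanced A) d (sumA : forall k, (\sum_r A r k = d)%N) i :
  i \in s -> exists y : 'I_n -> int,
  forall k, k \in s -> \sum_r y r * (A r k)%:Z = (k == i)%:R.
Proof.
move=> si; have [w [w0 wi]] := separating_vector si.
pose K := (\sum_r `|w r|).+1%N; pose p (r : 'I_n) := absz (K%:Z + w r).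
have pE r : (p r)%:Z = K%:Z + w r.
  rewrite gez0_abs // /K (bigD1 r) //=; lia.
have p0 r : (0 < p r)%N.
  rewrite -ltz_nat pE /K (bigD1 r) //=; lia.
pose T := {r : 'I_n & 'I_(p r)}; pose pi (x : T) := tag x.
have A01 r k : A r k = (A r k == 1%N) :> nat by case: (proj1 balA r k) => ->.
have eE x k : A (pi x) k = (x \in edge A pi k) by rewrite inE [LHS]A01.
have card_edge k : #|edge A pi k| = (\sum_r A r k * p r)%N.
  rewrite -sum1_card big_mkcond /=.
  transitivity (\sum_(x : T) A (pi x) k * 1)%N.
    by apply: eq_bigr => x _; rewrite muln1 eE; case: (x \in _).
  rewrite (sum_tagged (fun r => A r k)); apply: eq_bigr => r _.
  by rewrite sum1_card card_ord.
have card_edgeE k : (#|edge A pi k|)%:Z = (K * d)%N%:Z + \sum_r w r * (A r k)%:Z.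
  rewrite card_edge -(sumA k) big_distrr /= !Posz_sum -big_split /=.
  by apply: eq_bigr => r _; rewrite !PoszM pE mulrC mulrDl.
(* [wi] gives the upper bound; it also forces column [i] to contain a one, whence the lower
   bound. *)
have card_edge_i : (0 < #|edge A pi i| < K * d)%N.
  rewrite -[X in _ && X]ltz_nat card_edgeE gtrDl wi andbT lt0n card_edge.
  apply/negP; rewrite sum_nat_eq0 => /forallP A0; move: wi.
  rewrite big1 // => r _; have := A0 r; rewrite muln_eq0 (gtn_eqF (p0 r)) orbF.
  by move/eqP->; rewrite mulr0.
(* Colours are taken in ['I_N.+1], so their number [K * d] is written as a successor. *)
have [N NE] : exists N, (K * d = N.+1)%N.
  by case: (K * d)%N card_edge_i => [|N]; [rewrite ltn0 andbF | exists N].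
rewrite NE in card_edgeE card_edge_i; case/andP: card_edge_i => ei0 eiN.
have card_edge_k k : k \in s -> k != i -> #|edge A pi k| = N.+1.
  by move=> ks ki; apply/eqP; rewrite -eqz_nat card_edgeE w0 // addr0.
have card_edge_le k : k \in s -> (#|edge A pi k| <= N.+1)%N.
  by have [->|ki] := eqVneq k i; rewrite ?(ltnW eiN) // => ks; rewrite card_edge_k.
have [c cinj] := @good_coloring _ _ A T pi balA N.
pose z a r := (\sum_(y < p r) (c (Tagged (fun r => 'I_(p r)) y) == a))%N.
have zE a k : k \in s -> (\sum_r A r k * z a r)%N = (a \in c @: edge A pi k).
  move=> ks; rewrite -(sum_tagged (fun r => A r k) (fun x => (c x == a : nat))).
  have [/imsetP[x xe ->]|nim] := boolP (a \in _).
    rewrite (bigD1 x) //= eE xe eqxx big1 // => x' x'x.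
    rewrite eE; have [x'e|//] := boolP (x' \in _); case: eqP => // e.
    by case/eqP: x'x; apply: (cinj _ (card_edge_le _ ks)).
  apply: big1 => x _; rewrite eE; have [xe|//] := boolP (x \in _).
  by case: eqP => // e; case/negP: nim; rewrite -e imset_f.
have /card_gt0P[x xe] := ei0.
have [b bP] : exists b, b \notin c @: edge A pi i.
  apply/existsP/contraT => /existsPn ball; move: eiN.
  rewrite ltnNge (leq_trans _ (leq_imset_card c _)) //.
  suff -> : c @: edge A pi i = setT by rewrite cardsT card_ord.
  by apply/setP => b; have := ball b; rewrite negbK inE.
exists (fun r => (z (c x) r)%:Z - (z b r)%:Z) => k ks.
transitivity ((c x \in c @: edge A pi k)%:Z - (b \in c @: edge A pi k)%:Z).
  rewrite -!zE // !Posz_sum -sumrB; apply: eq_bigr => r _.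
  by rewrite mulrBl !PoszM ![(A r k)%:Z * _]mulrC.
have [->|ki] := eqVneq k i; first by rewrite imset_f // (negbTE bP).
suff -> : c @: edge A pi k = setT by rewrite !inE subrr.
apply/eqP; rewrite eqEcard subsetT cardsT card_ord.
by rewrite (card_in_imset (cinj k (card_edge_le _ ks))) card_edge_k ?leqnn.
Qed.

End DualVector.

(** * Faces of the initial complex *)

Section Triangulation.
Local Open Scope ring_scope.
Variables (K : fieldType) (n q : nat) (A : 'M[nat]_(n, q)).

Definition expo (m : 'X_{1..q}) : 'X_{1..n} := [multinom (\sum_j m j * A i j)%N | i < n].

Lemma expoD m1 m2 : expo (m1 + m2)%MM = (expo m1 + expo m2)%MM.
Proof.
apply/mnmP => i; rewrite mnmDE !mnmE -big_split /=.
by apply: eq_bigr => j _; rewrite mnmDE mulnDl.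
Qed.

Lemma toric_mapX m : toric_map A 'X_[m] = 'X_[expo m] :> {mpoly K[n]}.
Proof.
rewrite /toric_map comp_mpolyX; under eq_bigr do rewrite tnth_mktuple.
rewrite mprodXnE; congr 'X_[_]; apply/mnmP => i; rewrite mnm_sumE mnmE.
by apply: eq_bigr => j _; rewrite mulmnE mnmE mulnC.
Qed.

(** The monomials of [f] with a given image must cancel under the toric map, so none is alone. *)
Lemma toric_ideal_msupp (f : {mpoly K[q]}) m0 :
    toric_ideal A f -> m0 \in msupp f ->
  exists m1, [/\ m1 \in msupp f, m1 != m0 & expo m1 = expo m0].
Proof.
move=> f0 m0f; have [/hasP[m1 m1f /andP[ne /eqP e]]|/hasPn none] :=
  boolP (has (fun m => (m != m0) && (expo m == expo m0)) (msupp f)).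
  by exists m1.
move/(congr1 (mcoeff (expo m0))): f0; rewrite /toric_map comp_mpolyEX mcoeff0 raddf_sum /=.
rewrite (bigD1_seq m0) ?msupp_uniq //= big1_seq ?addr0.
  rewrite mcoeffZ -/(toric_map A _) toric_mapX mcoeffX eqxx mulr1 => /eqP.
  by rewrite mcoeff_eq0 m0f.
move=> m /andP[ne mf]; rewrite mcoeffZ -/(toric_map A _) toric_mapX mcoeffX.
by have := none m mf; rewrite ne /= => /negbTE ->; rewrite mulr0.
Qed.

Lemma ideal_gen_msupp (G : {mpoly K[q]} -> Prop) f m :
    ideal_gen G f -> m \in msupp f ->
  exists g m', [/\ G g, m' \in msupp g & (m' <= m)%MM].
Proof.
case=> l [lG ->]; rewrite mcoeff_msupp raddf_sum /= => nz.
have [/hasP[p pl]|/hasPn none] := boolP (has (fun p => (p.1 * p.2)@_m != 0) l).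
  rewrite -mcoeff_msupp => /msuppM_le/allpairsP[[m1 m2] /= [_ m2p ->]].
  by exists p.2, m2; split; [apply: lG | | apply: lem_addl].
case/eqP: nz; apply: big1_seq => p /andP[_ pl]; apply/eqP.
by have := none p pl; rewrite negbK.
Qed.

Lemma ideal_gen_incl (G : {mpoly K[q]} -> Prop) g : G g -> ideal_gen G g.
Proof.
move=> Gg; exists [:: (1, g)]; rewrite big_seq1 mul1r; split=> // p.
by rewrite inE => /eqP ->.
Qed.

Definition mset (s : {set 'I_q}) : 'X_{1..q} := (\sum_(i in s) U_(i))%MM.

Lemma msetE s i : mset s i = (i \in s).
Proof.
rewrite mnm_sumE; have [si|si] := boolP (i \in s).
  by rewrite (bigD1 i) //= mnmE eqxx big1 // => j /andP[_ /negbTE ji]; rewrite mnmE ji.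
by apply: big1 => j sj; rewrite mnmE; case: eqP sj si => // -> ->.
Qed.

Lemma prodX_mset (s : {set 'I_q}) : \prod_(i in s) 'X_i = 'X_[mset s] :> {mpoly K[q]}.
Proof. by rewrite mprodXE. Qed.

Variables (le : rel 'X_{1..q}) (Delta : {set {set 'I_q}}).
Hypothesis ordle : term_order le.
Hypothesis cplx : simplicial_complex Delta.
Hypothesis SR : forall f : {mpoly K[q]},
  SR_ideal Delta f <-> radical (initial_ideal le (toric_ideal A)) f.

Let ord_refl : reflexive le. Proof. by case: ordle. Qed.
Let ord_anti : antisymmetric le. Proof. by case: ordle. Qed.
Let ord_trans : transitive le. Proof. by case: ordle. Qed.
Let ord_total : total le. Proof. by case: ordle. Qed.
Let ordD m1 m2 m : le m1 m2 -> le (m1 + m)%MM (m2 + m)%MM.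
Proof. by case: ordle => _ _ _ _ [_]; apply. Qed.

(** A power of the squarefree monomial of a non-face is divisible by the leading monomial of some
    [f] in the toric ideal, and [f] has another monomial with the same image. Conversely, ['X_[m0] -
    'X_[m1]] puts ['X_[m0]] in the Stanley-Reisner ideal, so the support of [m0], hence [s],
    contains a non-face. *)
Lemma nonface_lead s : s \notin Delta <->
  exists m0 m1, [/\ le m1 m0, m1 != m0, expo m1 = expo m0 &
                    forall i, i \notin s -> m0 i = 0%N].
Proof.
split=> [sD|[m0 [m1 [m10 ne e ms]]]].
  have /SR[k kI] : SR_ideal Delta ('X_[mset s] : {mpoly K[q]}).
    by apply: ideal_gen_incl; exists s; rewrite prodX_mset.
  have : (mset s *+ k)%MM \in msupp ('X_[mset s] ^+ k : {mpoly K[q]}).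
    by rewrite mpolyXn; apply/mem_msuppXP.
  move=> /(ideal_gen_msupp kI)[g [m' [[f [m0 [f0 [m0f lead] ->]]]]]] /mem_msuppXP <- m0s.
  have [m1 [m1f ne e]] := toric_ideal_msupp f0 m0f.
  exists m0, m1; split=> // [|i si]; first exact: lead.
  by have := mnm_lepP m0s i; rewrite mulmnE msetE (negbTE si) leqn0 => /eqP.
apply/negP => sD.
pose f : {mpoly K[q]} := 'X_[m0] - 'X_[m1].
have f0 : toric_ideal A f.
  rewrite /toric_ideal /toric_map comp_mpolyB -!/(toric_map A _) !toric_mapX e subrr //.
have fl : is_lead le f m0.
  split; first by rewrite mcoeff_msupp mcoeffB !mcoeffX eqxx (negbTE ne) subr0 oner_neq0.
  move=> m /msuppB_le; rewrite mem_cat => /orP[]/mem_msuppXP <- //.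
have : SR_ideal Delta ('X_[m0] : {mpoly K[q]}).
  by apply/SR; exists 1%N; rewrite expr1; apply: ideal_gen_incl; exists f, m0.
have m0X : m0 \in msupp ('X_[m0] : {mpoly K[q]}) by apply/mem_msuppXP.
move=> /ideal_gen_msupp/(_ m0X)[g [m' [[t [tD ->]]]]]; rewrite prodX_mset => /mem_msuppXP <- tm0.
case/negP: tD; apply: cplx sD _; apply/subsetP => i ti; apply: contraT => /ms i0.
by have := mnm_lepP tm0 i; rewrite msetE ti i0.
Qed.

(* The order on monomials extended to the kernel of [A] in [Z^q]. *)
Definition mdiff (m0 m1 : 'X_{1..q}) : 'rV[int]_q := \row_k ((m0 k)%:Z - (m1 k)%:Z).

Definition nneg (a : 'rV[int]_q) : Prop :=
  exists m0 m1, [/\ le m1 m0, expo m1 = expo m0 & a = mdiff m0 m1].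

Definition is_relation (a : 'rV[int]_q) : Prop := forall r, \sum_k a 0 k * (A r k)%:Z = 0.

Lemma nneg0 : nneg 0.
Proof. by exists 0%MM, 0%MM; split=> //; apply/rowP => k; rewrite !mxE subrr. Qed.

Lemma nnegD a b : nneg a -> nneg b -> nneg (a + b).
Proof.
case=> [m0 [m1 [l e ->]]] [m0' [m1' [l' e' ->]]].
exists (m0 + m0')%MM, (m1 + m1')%MM; split; last 1 first.
- by apply/rowP => k; rewrite !mxE !mnmDE !PoszD opprD addrACA.
- by apply: (@ord_trans (m0 + m1')%MM); [apply: ordD | rewrite ![(m0 + _)%MM]addmC; apply: ordD].
- by rewrite !expoD e e'.
Qed.

Lemma nnegMn a l : nneg a -> nneg (a *+ l).
Proof.
move=> an; elim: l => [|l IH]; first exact: nneg0.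
by rewrite mulrS; apply: nnegD.
Qed.

Lemma nneg_sum (I : finType) (P : pred I) (a : I -> 'rV[int]_q) (l : I -> nat) :
  (forall i, P i -> nneg (a i)) -> nneg (\sum_(i | P i) a i *+ l i).
Proof.
move=> aP; apply: (big_ind nneg) => [|a' b'|i Pi]; [exact: nneg0|exact: nnegD|].
exact/nnegMn/aP.
Qed.

(** The two comparisons add up to an equality of monomials, so neither is strict. *)
Lemma nneg_anti a : nneg a -> nneg (- a) -> a = 0.
Proof.
case=> [m0 [m1 [l e ->]]] [m0' [m1' [l' e' E]]].
have Em : (m0 + m0' = m1 + m1')%MM.
  by apply/mnmP => k; move/rowP/(_ k): E; rewrite !mxE !mnmDE; lia.
have : (m1 + m1' = m0 + m1')%MM.
  apply: ord_anti; rewrite ordD //= -Em ![(m0 + _)%MM]addmC; exact: ordD.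
by move/addIm ->; apply/rowP => k; rewrite !mxE subrr.
Qed.

Lemma nneg_relation a : nneg a -> is_relation a.
Proof.
case=> [m0 [m1 [_ e ->]]] r; move/mnmP/(_ r): e; rewrite !mnmE => e.
transitivity ((\sum_j m0 j * A r j)%N%:Z - (\sum_j m1 j * A r j)%N%:Z).
  by rewrite !Posz_sum -sumrB; apply: eq_bigr => k _; rewrite mxE mulrBl !PoszM.
by rewrite e subrr.
Qed.

Lemma relation_nneg a : is_relation a -> nneg a \/ nneg (- a).
Proof.
move=> ra.
pose pos k := if 0 <= a 0 k then absz (a 0 k) else 0%N.
pose neg k := if 0 <= a 0 k then 0%N else absz (a 0 k).
pose m0 : 'X_{1..q} := [multinom pos k | k < q].
pose m1 : 'X_{1..q} := [multinom neg k | k < q].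
have aE : a = mdiff m0 m1.
  by apply/rowP => k; rewrite !mxE !mnmE /pos /neg; case: ifP; lia.
have e : expo m1 = expo m0.
  apply/mnmP => r; rewrite !mnmE; apply/eqP; rewrite -eqz_nat eq_sym -subr_eq0.
  rewrite !Posz_sum -sumrB -[X in _ == X](ra r); apply/eqP/eq_bigr => k _.
  by rewrite !PoszM -mulrBl [in RHS]aE mxE.
have [l|l] := orP (ord_total m1 m0); [left; by exists m0, m1|right].
by exists m1, m0; split=> //; rewrite aE; apply/rowP => k; rewrite !mxE opprB.
Qed.

Lemma nonfaceP s : s \notin Delta <->
  exists a, [/\ nneg a, a != 0 & forall k, k \notin s -> a 0 k <= 0].
Proof.
split=> [/nonface_lead[m0 [m1 [l ne e ms]]]|[a [[m0 [m1 [l e ->]]] a0 as_]]].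
  exists (mdiff m0 m1); split=> [||k ks]; first by exists m0, m1.
    apply: contraNneq ne => /rowP E; apply/eqP/mnmP => k; have := E k.
    by rewrite !mxE; lia.
  by rewrite mxE ms //; lia.
(* [g] is the exponent of the gcd. Once it is cancelled, the support of [m0 - m1] consists of the
   positive entries of the relation; the order is preserved, since adding [g] back to a reversed
   comparison would contradict [l]. *)
apply/nonface_lead; pose g : 'X_{1..q} := [multinom minn (m0 k) (m1 k) | k < q].
have E0 : (m0 = (m0 - m1) + g)%MM by apply/mnmP => k; rewrite mnmDE mnmBE mnmE; lia.
have E1 : (m1 = (m1 - m0) + g)%MM by apply/mnmP => k; rewrite mnmDE mnmBE mnmE; lia.
have ne : (m1 != m0)%MM.
  by apply: contraNneq a0 => ->; apply/eqP/rowP => k; rewrite !mxE subrr.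
exists (m0 - m1)%MM, (m1 - m0)%MM; split.
- have /orP[//|/(ordD g)] := ord_total (m1 - m0)%MM (m0 - m1)%MM.
  by rewrite -E0 -E1 => l'; case/eqP: ne; apply: ord_anti; rewrite l.
- by apply: contraNneq ne => E; rewrite E1 E -E0.
- by apply: (@addIm _ (expo g)); rewrite -!expoD -E0 -E1.
- by move=> k ks; have := as_ k ks; rewrite mxE mnmBE; lia.
Qed.

Lemma face_free s : s \in Delta -> forall a : 'I_q -> int,
  (forall k, k \notin s -> a k = 0) ->
  (forall r, \sum_k a k * (A r k)%:Z = 0) -> forall k, a k = 0.
Proof.
move=> sD a as_ ra; pose v := \row_k a k.
have [v0 k|v0] := eqVneq v 0; first by have /rowP/(_ k) := v0; rewrite !mxE.
suff : s \notin Delta by rewrite sD.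
have rv : is_relation v by move=> r; rewrite -[RHS](ra r); apply: eq_bigr => k _; rewrite mxE.
apply/nonfaceP; have [va|va] := relation_nneg rv; [exists v|exists (- v)]; split=> //.
- by move=> k ks; rewrite mxE as_.
- by rewrite oppr_eq0.
- by move=> k ks; rewrite !mxE as_.
Qed.

(* For [j] outside the facet [s], the non-face [j |: s] provides a positive
   relation whose only positive entry outside [s] is the [j]-th one.  The
   matrix of these relations has non-positive off-diagonal entries and, as [s]
   is a face, no non-trivial non-negative combination of its rows is
   non-positive; hence it is invertible, like an M-matrix. *)
Lemma facet_span s j : s \in facets Delta -> j \notin s ->
  exists b, [/\ is_relation b, b 0 j != 0 &
                forall k, k \notin s -> k != j -> b 0 k = 0].
Proof.
rewrite inE => /maxsetP[sD smax] js.
have noneg a : nneg a -> (forall k, k \notin s -> a 0 k <= 0) -> a = 0.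
  move=> an as_; apply/eqP; apply: contraLR sD => a0; apply/nonfaceP.
  by exists a.
have /fin_all_exists[a aP] (i : 'I_q) : exists a, i \notin s ->
    [/\ nneg a, a != 0, 0 < a 0 i & forall k, k \notin s -> k != i -> a 0 k <= 0].
  have [si|si] := boolP (i \in s); first by exists 0.
  have : i |: s \notin Delta.
    by apply: contra si => /smax/(_ (subsetUr _ _)) <-; rewrite setU11.
  case/nonfaceP => a [an a0 as_]; exists a => _.
  have as' k : k \notin s -> k != i -> a 0 k <= 0.
    by move=> ks ki; apply: as_; rewrite !inE negb_or ki.
  split=> //; rewrite ltNge; apply: contraNN a0 => ai; apply/eqP/noneg => // k ks.
  by have [->|/as'->] := eqVneq k i.
(* The rows indexed by [s] are those of the identity, so [\det M] is that of the block outside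
   [s]. *)
pose M : 'M[int]_q := \matrix_(i, k) if i \in s then (i == k)%:R else a i 0 k.
have mulM (c : 'rV[int]_q) k : k \notin s ->
    (c *m M) 0 k = \sum_(i | i \notin s) c 0 i * a i 0 k.
  move=> ks; rewrite mxE (bigID (mem s)) /= big1 ?add0r => [|i si].
    by apply: eq_bigr => i si; rewrite mxE (negbTE si).
  by rewrite mxE si; case: eqP si ks => [-> ->|] //; rewrite mulr0.
have detM : \det M != 0.
  apply/det0P => -[v v0 vM]; case/eqP: v0.
  have vs i : i \notin s -> v 0 i = 0.
    move=> si; apply/eqP; apply: contraT => vi.
    (* The coefficients become the absolute values of those of [v]; by the triangle inequality, at
       each index outside [s] the diagonal term is at most the size of the non-positive off-diagonal
       ones. *)
    pose b := \sum_(i | i \notin s) a i *+ absz (v 0 i).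
    have bE k : b 0 k = \sum_(i | i \notin s) `|v 0 i| * a i 0 k.
      rewrite summxE; apply: eq_bigr => l _.
      by rewrite mulmxnE pmulrn -mulrzl intz abszE.
    have b0 : b = 0.
      apply: noneg => [|k ks]; first by apply: nneg_sum => l /aP[].
      have [_ _ ak _] := aP k ks.
      have := mulM v k ks; rewrite vM mxE bE !(bigD1 k ks) /= => e.
      rewrite -[X in _ * X](gtr0_norm ak) -normrM.
      have -> : v 0 k * a k 0 k = - \sum_(l | (l \notin s) && (l != k)) v 0 l * a l 0 k.
        by apply/eqP; rewrite -addr_eq0 -e.
      rewrite normrN -lerBrDr sub0r; apply: le_trans (ler_norm_sum _ _ _) _.
      rewrite -sumrN; apply: ler_sum => l /andP[ls lk].
      have [_ _ _ al] := aP l ls.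
      by rewrite normrM (ler0_norm (al k ks _)) ?mulrN // eq_sym.
    (* As [a i] occurs in [b = 0] with positive multiplicity, [- a i] is a sum of [nneg] terms. *)
    have [an /eqP[]] := aP i si; apply: nneg_anti => //.
    suff -> : - a i = a i *+ (absz (v 0 i)).-1
                      + \sum_(l | (l \notin s) && (l != i)) a l *+ absz (v 0 l).
      by apply: nnegD; [apply: nnegMn | apply: nneg_sum => l /andP[/aP[]]].
    apply/eqP; rewrite eq_sym -subr_eq0 opprK addrAC -mulrSr prednK ?absz_gt0 //.
    by rewrite -(bigD1 i si) -/b b0.
  apply/rowP => k; rewrite [RHS]mxE; have [ks|/vs//] := boolP (k \in s).
  have : (v *m M) 0 k = 0 by rewrite vM mxE.
  rewrite mxE (bigD1 k) //= big1 ?addr0 ?mxE ?ks ?eqxx ?mulr1 // => l lk.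
  rewrite mxE; case: ifP => [_|/negbT/vs->]; last by rewrite mul0r.
  by rewrite (negbTE lk) mulr0.
(* Row [j] of the adjugate combines the rows of [M] into [\det M] at [j] and 0 elsewhere. *)
pose c := row j (\adj M).
have cM k : (c *m M) 0 k = \det M *+ (j == k) by rewrite -row_mul mul_adj_mx !mxE.
exists (\sum_(i | i \notin s) c 0 i *: a i).
have bE k : (\sum_(i | i \notin s) c 0 i *: a i) 0 k = \sum_(i | i \notin s) c 0 i * a i 0 k.
  by rewrite summxE; apply: eq_bigr => i _; rewrite mxE.
split=> [r||k ks kj].
- under eq_bigr do rewrite bE mulr_suml.
  rewrite exchange_big big1 //= => i /aP[/nneg_relation ra _ _ _].
  under eq_bigr do rewrite -mulrA.
  by rewrite -mulr_sumr ra mulr0.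
- by rewrite bE -mulM // cM eqxx.
- by rewrite bE -mulM // cM eq_sym (negbTE kj).
Qed.

End Triangulation.

(** * Integral spans *)

Section IntegralSpan.
Local Open Scope ring_scope.

Lemma inIntSpan_map (V : zmodType) (I : eqType) (f : I -> V) (l : seq I) u :
  uniq l ->
  inIntSpan (in_tuple (map f l)) u <-> exists x : I -> int, u = \sum_(i <- l) f i *~ x i.
Proof.
case: l => [_|i0 l' lu].
  by split=> [[a ->]|[x ->]]; [exists (fun=> 0) | exists [ffun=> 0]];
    rewrite big_ord0 big_nil.
set l := i0 :: l' in lu *; have sz : size (map f l) = size l by rewrite size_map.
split=> [[a ->]|[x ->]].
  (* As [l] is duplicate-free, [index i l] recovers the position of [i]; the default 0 is not
     reached on [l]. *)
  exists (fun i => oapp a 0 (insub (index i l))).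
  rewrite (big_nth i0) big_mkord -sz; apply: eq_bigr => i _.
  have il : (i < size l)%N by rewrite -sz.
  by rewrite (nth_map i0) // index_uniq // valK.
exists [ffun i : 'I_(size (map f l)) => x (nth i0 l i)].
rewrite (big_nth i0) big_mkord -sz; apply: eq_bigr => i _.
by rewrite ffunE (nth_map i0) // -sz.
Qed.

Lemma ZSpanP n q (A : 'M[nat]_(n, q)) (s : {set 'I_q}) u :
  ZSpan A s u <-> exists x : 'I_q -> int, u = \sum_(j in s) colvec A j *~ x j.
Proof.
rewrite /ZSpan /image_mem inIntSpan_map ?enum_uniq //.
by split=> -[x ->]; exists x; rewrite big_enum.
Qed.

Lemma ZSpan_subset n q (A : 'M[nat]_(n, q)) (s : {set 'I_q}) :
  (forall j, ZSpan A s (colvec A j)) ->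
  forall u, ZSpan A s u <-> ZSpan A [set: 'I_q] u.
Proof.
move=> sP u; split=> /ZSpanP[x ->]; apply/ZSpanP.
  exists (fun j => if j \in s then x j else 0).
  rewrite [RHS](bigID (mem s)) /= [X in _ + X]big1 ?addr0 => [|j /andP[_ /negbTE->]] //.
  by apply: eq_big => [j|j ->] //; rewrite inE.
have /fin_all_exists[y yP] j :
    exists y : 'I_q -> int, colvec A j = \sum_(k in s) colvec A k *~ y k.
  by apply/ZSpanP.
exists (fun k => \sum_(j in [set: 'I_q]) y j k * x j).
under eq_bigr do rewrite yP mulrz_suml.
rewrite exchange_big /=; apply: eq_bigr => k _.
by rewrite mulrz_sumr; apply: eq_bigr => j _; rewrite mulrzA.
Qed.

End IntegralSpan.

(** * Integral coordinates of all columns with respect to a facet *)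

Theorem theorem5p6 (K : fieldType) (n q : nat) (A : 'M[nat]_(n, q))
    (hbal : balanced A)
    (hdist : injective (fun j : 'I_q => col j A))
    (d : int) (hd : forall j : 'I_q, vsum (colvec A j) = d)
    (F : {set {set 'I_q}}) (hF : regular_triangulation K A F) :
  unimodular_family A F.
Proof.
have [le [Delta [ordle cplx SR ->]]] := hF => s sF.
have sD : s \in Delta by move: sF; rewrite inE => /maxsetP[].
have dN k : (\sum_r A r k)%N = `|d|%N.
  apply/eqP; rewrite -eqz_nat gez0_abs -(hd k); last by apply: sumr_ge0 => r _; rewrite mxE.
  by apply/eqP; rewrite Posz_sum; apply: eq_bigr => r _; rewrite mxE.
have free := face_free ordle cplx SR sD.
have /fin_all_exists[y yP] (i : 'I_q) : exists y : 'I_n -> int, i \in s ->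
    forall k, k \in s -> (\sum_r y r * (A r k)%:Z = (k == i)%:R)%R.
  have [si|si] := boolP (i \in s); last by exists (fun=> 0%R).
  by have [y yP] := dual_vector free hbal dN si; exists y.
apply: ZSpan_subset => j; apply/ZSpanP.
have [sj|sj] := boolP (j \in s).
  exists (fun k => (k == j)%:R%R).
  by rewrite (bigD1 j) //= eqxx big1 ?addr0 // => k /andP[_ /negbTE ->].
have [b [rb bj bs]] := facet_span ordle cplx SR sF sj.
(* The rational coordinate of column [j] along column [i] of the facet is its pairing with the dual
   vector [y i], hence an integer. *)
pose x i := (\sum_r y i r * (A r j)%:Z)%R.
have split_b (G : 'I_q -> int) :
    (\sum_k b 0 k * G k = b 0 j * G j + \sum_(k in s) b 0 k * G k)%R.
  rewrite (bigD1 j) //= (bigID (mem s)) /= [X in (_ + (_ + X))%R]big1 ?addr0.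
    congr (_ + _)%R; apply: eq_bigl => k.
    by case: eqP => // ->; rewrite (negbTE sj).
  by move=> k /andP[kj ks]; rewrite bs ?mul0r.
(* Pairing the relation [b] with [y i] leaves only the terms of [i] and [j]. *)
have bx i : i \in s -> (b 0 i = - (b 0 j * x i))%R.
  move=> si; apply/eqP; rewrite -addr_eq0 addrC /x.
  have := split_b (fun k => \sum_r y i r * (A r k)%:Z)%R.
  rewrite (bigD1 i si) /= (yP i si i si) eqxx mulr1 [X in (_ + (_ + X))%R]big1 => [|k /andP[ks ki]].
    rewrite addr0 => <-; under eq_bigr do rewrite mulr_sumr.
    rewrite exchange_big big1 //= => r _.
    under eq_bigr do rewrite mulrCA.
    by rewrite -mulr_sumr rb mulr0.
  by rewrite (yP i si k ks) (negbTE ki) mulr0.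
exists x; apply/colP => r; apply: (mulfI bj).
have := rb r; rewrite split_b => /eqP; rewrite addr_eq0 => /eqP e.
rewrite mxE e summxE mulr_sumr -sumrN; apply: eq_bigr => k ks.
by rewrite (bx k ks) -scaler_int !mxE intz mulNr opprK mulrA.
Qed.
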